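(* Let $(a_n)_{n\in\mathbb N}$ be complex numbers such that the Nörlund matrix $N_{|{\bf a}|}$ associated with $(|a_n|)_{n\in\mathbb N}$ is bounded on $\ell^2(\mathbb N)$, and let $A_n=\sum_{k=0}^n|a_k|$. Let $P$ be a contraction on $L^2(m)$ for a ($\sigma$-finite) measure space $(Y,m)$, and let $f\in L^2(m)$ satisfy $$\sum_{n\ge1}(\log(n+1))^2A_{2^{n+1}}^2\|P^{2^n}f\|_{L^2(m)}^2<\infty .$$ Then the series $\sum_{n\in\mathbb N}a_nP^nf$ converges $m$-almost everywhere and $\sup_{N\ge1}\big|\sum_{n=0}^Na_nP^nf\big|\in L^2(m)$.
   Context: For a sequence ${\bf b}=(b_n)$ of complex numbers with $B_i=\sum_{k=0}^i|b_k|$, the Nörlund matrix $N_{\bf b}$ has entries $b_{i-j}/B_i$ for $0\le j\le i$ with $B_i>0$ and $0$ otherwise; it is bounded on $\ell^2(\mathbb N)$ if $\|N_{\bf b}u\|_{\ell^2}\le C\|u\|_{\ell^2}$ for all finitely supported $u$. $P$ is a (not necessarily positive) linear operator of norm at most $1$ on $L^2(m)$. *)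

(* Defs.v *)
From mathcomp Require Import all_boot all_order all_algebra.
From mathcomp Require Import complex.
From mathcomp Require Import all_classical all_reals all_analysis.
From mathcomp Require Import measurable_realfun.
Import Order.TTheory GRing.Theory Num.Theory.
Import numFieldNormedType.Exports.
Import ComplexField.Normc.
Set Implicit Arguments. Unset Strict Implicit. Unset Printing Implicit Defensive.
Local Open Scope classical_set_scope.
Local Open Scope ring_scope.

Section Norlund.
Variable R : realType.

Definition normsum (b : nat -> R[i]) (i : nat) : R := \sum_(k < i.+1) normc (b k).

Definition norlund_entry (b : nat -> R[i]) (i j : nat) : R[i] :=
  if (j <= i)%N && (0 < normsum b i) then b (i - j)%N / (normsum b i)%:C%C else 0.

(* N_b is bounded on l^2(N): ||N_b u||_2 <= C ||u||_2 for every finitely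
   supported u (support in [0,K)); ||N_b u||_2 is the sup over M of the
   square roots of the partial sums of |(N_b u)_i|^2. *)
Definition norlund_bounded (b : nat -> R[i]) : Prop :=
  exists C : R, forall (u : nat -> R[i]) (K : nat),
    (forall j, (K <= j)%N -> u j = 0) ->
    forall M : nat,
      Num.sqrt (\sum_(i < M) normc (\sum_(j < K) norlund_entry b i j * u j) ^+ 2)
      <= C * Num.sqrt (\sum_(j < K) normc (u j) ^+ 2).

Definition cvgC (u : nat -> R[i]) : Prop :=
  exists l : R[i], (fun N => normc (u N - l)) @ \oo --> (0 : R).
End Norlund.

Section L2.
Variables (R : realType) (d : measure_display) (Y : measurableType d)
  (m : {measure set Y -> \bar R}).

Definition Cmeasurable (f : Y -> R[i]) : Prop :=
  measurable_fun setT (fun x => complex.Re (f x)) /\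
  measurable_fun setT (fun x => complex.Im (f x)).

Definition L2sq (f : Y -> R[i]) : \bar R := \int[m]_x ((normc (f x)) ^+ 2)%:E.

Definition inL2 (f : Y -> R[i]) : Prop := Cmeasurable f /\ (L2sq f < +oo)%E.

(* P is a (not necessarily positive) linear operator of norm <= 1 on L^2(m);
   it is represented on representatives, linearity holding m-a.e. *)
Definition L2_contraction (P : (Y -> R[i]) -> (Y -> R[i])) : Prop :=
  [/\ (forall f, inL2 f -> inL2 (P f)),
      (forall f g, inL2 f -> inL2 g ->
         {ae m, forall x, P (fun y => f y + g y) x = P f x + P g x}),
      (forall (c : R[i]) f, inL2 f ->
         {ae m, forall x, P (fun y => c * f y) x = c * P f x}) &
      (forall f, inL2 f -> (L2sq (P f) <= L2sq f)%E)].

Definition inL2e (F : Y -> \bar R) : Prop :=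
  measurable_fun setT F /\ (\int[m]_x (F x * F x) < +oo)%E.
End L2.

(* Main.v *)
Require Import Defs.
From mathcomp Require Import all_boot all_order all_algebra.
From mathcomp Require Import complex.
From mathcomp Require Import all_classical all_reals all_analysis.
From mathcomp Require Import measurable_realfun.
From mathcomp Require Import ring lra zify.
Import Order.TTheory GRing.Theory Num.Theory.
Import numFieldNormedType.Exports.
Import ComplexField.Normc.
Local Open Scope classical_set_scope.
Local Open Scope ring_scope.

Set Implicit Arguments. Unset Strict Implicit. Unset Printing Implicit Defensive.

(* With the defect seminorm |g|_D^2 = |g|^2 - |P g|^2 one has
   |g|^2 = sum_(n < K) |P^n g|_D^2 + |P^K g|^2. Applied to a block
   g = sum_(2^p <= j < 2^q) a_j P^j f, whose n-th defect is at most
   sum_j |a_j| |P^(n+j) f|_D, boundedness of the adjoint of N_|a| gives the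
   quasi-orthogonality
     |g|^2 <= C sum_(p <= n < q) A_(2^(n+1))^2 |P^(2^n) f|^2.
   The Rademacher-Menshov argument then controls the partial sums along dyadic
   times, the squared logarithm being its usual loss; inside one dyadic block of
   times the triangle inequality suffices. *)

(** [P] acts on representatives and is linear only almost everywhere. To compute with exact
    identities, the orbit is carried by [{poly R[i]}]: ['X^n] stands for [P^n f] and multiplication
    by ['X] for [P], the pulled-back L2 norm being a seminorm. The defect form is
    [<x, y> - <P x, P y>], so neither the adjoint of [P] nor a square root has to be built. Its
    value at [P^i f] is what the orbit loses at time i. The adjoint matrix weighs this loss by
    [A_i^2]; over a dyadic block of times the weight is at most [A_(2^(n+1))^2] and the losses
    telescope below [|P^(2^n) f|^2], whence the terms of the hypothesis. The logarithm there is that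
    of the exponent n, because Rademacher-Menshov is applied to the partial sums at times [2^n],
    indexed by n. *)

(** * The modulus on complex numbers *)

Section ComplexNorm.
Variable R : realType.
Implicit Types z w : R[i].

Lemma normc_ge0 z : 0 <= normc z.
Proof. by case: z => x y; rewrite /normc /= sqrtr_ge0. Qed.

Lemma sqr_normc_ReIm z :
  normc z ^+ 2 = complex.Re z ^+ 2 + complex.Im z ^+ 2.
Proof. by case: z => x y; rewrite /normc /= sqr_sqrtr// addr_ge0// sqr_ge0. Qed.

Lemma normcN z : normc (- z) = normc z.
Proof. by case: z => x y; rewrite /normc /= !sqrrN. Qed.

Lemma normcB z w : normc (z - w) = normc (w - z).
Proof. by rewrite -normcN opprB. Qed.

Lemma ler_normcD z w : normc (z + w) <= normc z + normc w.
Proof. exact: le_normcD. Qed.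

Lemma ler_normc_sum (I : Type) (r : seq I) (F : I -> R[i]) :
  normc (\sum_(i <- r) F i) <= \sum_(i <- r) normc (F i).
Proof.
elim: r => [|i r IH]; first by rewrite !big_nil normc0.
by rewrite !big_cons; apply: le_trans (ler_normcD _ _) _; rewrite lerD2l.
Qed.

Lemma normc_real (x : R) : normc x%:C%C = `|x|.
Proof. by rewrite /normc /= expr0n /= addr0 sqrtr_sqr. Qed.

Lemma ReD z w : complex.Re (z + w) = complex.Re z + complex.Re w.
Proof. by case: z w => [x y] [x' y']. Qed.

Lemma ImD z w : complex.Im (z + w) = complex.Im z + complex.Im w.
Proof. by case: z w => [x y] [x' y']. Qed.

Lemma ReM z w : complex.Re (z * w) =
  complex.Re z * complex.Re w - complex.Im z * complex.Im w.
Proof. by case: z w => [x y] [x' y']. Qed.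

Lemma ImM z w : complex.Im (z * w) =
  complex.Re z * complex.Im w + complex.Im z * complex.Re w.
Proof. by case: z w => [x y] [x' y']. Qed.

Lemma normc_ge_absRe z : `|complex.Re z| <= normc z.
Proof.
by case: z => x y; rewrite /normc /= -sqrtr_sqr ler_wsqrtr// lerDl sqr_ge0.
Qed.

Lemma normc_ge_absIm z : `|complex.Im z| <= normc z.
Proof.
by case: z => x y; rewrite /normc /= -sqrtr_sqr ler_wsqrtr// lerDr sqr_ge0.
Qed.

Lemma normc_le_ReIm z : normc z <= `|complex.Re z| + `|complex.Im z|.
Proof.
rewrite -(ler_pXn2r (n := 2))// ?nnegrE ?addr_ge0 ?normc_ge0//.
rewrite sqr_normc_ReIm -(real_normK (num_real (complex.Re z))).
rewrite -(real_normK (num_real (complex.Im z))).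
have : 0 <= `|complex.Re z| * `|complex.Im z| by rewrite mulr_ge0.
nra.
Qed.

End ComplexNorm.

(** * Cauchy-Schwarz inequalities for finite sums *)

Section FiniteSums.
Variable R : realType.

Lemma quadratic_ge0_discr (a b c : R) : 0 <= c ->
  (forall t, 0 <= a + t * b + t ^+ 2 * c) -> b ^+ 2 <= 4 * a * c.
Proof.
move=> c0 H; have [cE|cn0] := eqVneq c 0.
  have [->|bn0] := eqVneq b 0; first by rewrite expr0n /= cE mulr0.
  (* For [c = 0] the polynomial is affine, and this argument gives it the value -1. *)
  have := H (- (a + 1) / b).
  by rewrite cE !mulr0 addr0 mulfVK//; lra.
have := H (- b / (2 * c)).
have -> : a + - b / (2 * c) * b + (- b / (2 * c)) ^+ 2 * c =
          (4 * a * c - b ^+ 2) / (4 * c) by field.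
have c4 : 0 < 4 * c by rewrite mulr_gt0// lt_def cn0.
by rewrite pmulr_lge0 ?invr_gt0// subr_ge0.
Qed.

Lemma Cauchy_Schwarz_sum (I : Type) (r : seq I) (F G : I -> R) :
  (\sum_(i <- r) F i * G i) ^+ 2 <=
  (\sum_(i <- r) F i ^+ 2) * (\sum_(i <- r) G i ^+ 2).
Proof.
have G0 : 0 <= \sum_(i <- r) G i ^+ 2 by apply: sumr_ge0 => i _; exact: sqr_ge0.
have := @quadratic_ge0_discr (\sum_(i <- r) F i ^+ 2)
  (2 * \sum_(i <- r) F i * G i) _ G0.
have H t : 0 <= \sum_(i <- r) F i ^+ 2 + t * (2 * \sum_(i <- r) F i * G i)
    + t ^+ 2 * \sum_(i <- r) G i ^+ 2.
  rewrite !mulr_sumr -!big_split /=; apply: sumr_ge0 => i _.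
  have := sqr_ge0 (F i + t * G i); nra.
by move=> /(_ H); nra.
Qed.

(** Cauchy-Schwarz after splitting each weight into two square roots, one for each factor. *)
Lemma weighted_Cauchy_Schwarz (I : Type) (r : seq I) (w F : I -> R) :
  (forall i, 0 <= w i) ->
  (\sum_(i <- r) w i * F i) ^+ 2 <=
  (\sum_(i <- r) w i) * (\sum_(i <- r) w i * F i ^+ 2).
Proof.
move=> w0.
have := Cauchy_Schwarz_sum r (fun i => Num.sqrt (w i))
          (fun i => Num.sqrt (w i) * F i).
under eq_bigr do rewrite mulrA -expr2 sqr_sqrtr//.
under [in X in _ <= X -> _]eq_bigr do rewrite sqr_sqrtr//.
by under [in X in _ <= _ * X -> _]eq_bigr do rewrite exprMn sqr_sqrtr//.
Qed.

Lemma sum_nat_mono (m n n' : nat) (F : nat -> R) :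
  (forall i, 0 <= F i) -> (m <= n)%N -> (n <= n')%N ->
  \sum_(m <= i < n) F i <= \sum_(m <= i < n') F i.
Proof.
move=> F0 mn nn'; rewrite (@big_cat_nat _ _ _ n m n')//= lerDl.
by apply: sumr_ge0.
Qed.

End FiniteSums.

(** * The adjoint Norlund matrix *)

Section AdjointNorlund.
Variables (R : realType) (a : nat -> R[i]).

Lemma normsum_ge0 i : 0 <= normsum a i.
Proof. by apply: sumr_ge0 => k _; exact: normc_ge0. Qed.

Lemma normsum_mono i j : (i <= j)%N -> normsum a i <= normsum a j.
Proof.
move=> ij; rewrite /normsum -!(big_mkord xpredT (fun k => normc (a k))).
by apply: sum_nat_mono => // k; exact: normc_ge0.
Qed.

Lemma normc_le_normsum k i : (k <= i)%N -> normc (a k) <= normsum a i.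
Proof.
move=> ki; apply: le_trans (normsum_mono ki).
by rewrite /normsum big_ord_recr /= lerDr; apply: sumr_ge0 => j _; exact: normc_ge0.
Qed.

Hypothesis ha : norlund_bounded (fun n => (normc (a n))%:C%C).

(** When [normsum a i] is 0 the quotient is 0 by the convention on inverses, which agrees with the
    default value in [norlund_entry]. *)
Let ent i j : R :=
  if (j <= i)%N then normc (a (i - j)%N) / normsum a i else 0.

Let norlund_entry_real i j :
  norlund_entry (fun n => (normc (a n))%:C%C) i j = (ent i j)%:C%C.
Proof.
have BE : normsum (fun n => (normc (a n))%:C%C) i = normsum a i.
  by apply: eq_bigr => k _; rewrite normc_real ger0_norm// normc_ge0.
rewrite /norlund_entry /ent BE; case: (j <= i)%N => //=.
case: ltP => [_|B0]; first by rewrite rmorphM fmorphV.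
have -> : normsum a i = 0 by apply/eqP; rewrite eq_le B0 normsum_ge0.
by rewrite invr0 mulr0.
Qed.

Let norlund_real_bound : exists C : R, forall (T : nat -> R) K M,
  \sum_(0 <= i < M) (\sum_(0 <= j < K) ent i j * T j) ^+ 2 <=
  C ^+ 2 * \sum_(0 <= j < K) T j ^+ 2.
Proof.
have [C HC] := ha; exists C => T K M.
pose u j := if (j < K)%N then (T j)%:C%C else 0 : R[i].
have u0 j : (K <= j)%N -> u j = 0 by rewrite /u ltnNge => ->.
have := HC u K u0 M.
have -> : \sum_(j < K) normc (u j) ^+ 2 = \sum_(0 <= j < K) T j ^+ 2.
  rewrite big_mkord; apply: eq_bigr => j _.
  by rewrite /u ltn_ord normc_real real_normK ?num_real.
have -> : \sum_(i < M) normc (\sum_(j < K)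
      norlund_entry (fun n => (normc (a n))%:C%C) i j * u j) ^+ 2 =
    \sum_(0 <= i < M) (\sum_(0 <= j < K) ent i j * T j) ^+ 2.
  rewrite big_mkord; apply: eq_bigr => i _; rewrite big_mkord.
  under eq_bigr do rewrite norlund_entry_real /u ltn_ord -rmorphM.
  by rewrite -rmorph_sum normc_real real_normK ?num_real.
set X := \sum_(0 <= i < M) _; set G := \sum_(0 <= j < K) _ => H.
have X0 : 0 <= X by apply: sumr_ge0 => i _; exact: sqr_ge0.
have G0 : 0 <= G by apply: sumr_ge0 => i _; exact: sqr_ge0.
rewrite -(sqr_sqrtr X0) -(sqr_sqrtr G0) -exprMn ler_pXn2r// ?nnegrE ?sqrtr_ge0//.
exact: le_trans (sqrtr_ge0 _) H.
Qed.

(* The adjoint of N_|a| carries u to sum_(i >= n) |a_(i-n)| u_i / A_i; it is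
   applied to u_i = A_i g_i. *)
Lemma adjoint_norlund_bound : exists C : R, forall (g : nat -> R) M,
  (forall i, (M <= i)%N -> g i = 0) ->
  \sum_(0 <= n < M) (\sum_(0 <= j < M) normc (a j) * g (n + j)%N) ^+ 2 <=
  C ^+ 2 * \sum_(0 <= i < M) normsum a i ^+ 2 * g i ^+ 2.
Proof.
have [C HC] := norlund_real_bound; exists C => g M gM.
pose T n := \sum_(0 <= j < M) normc (a j) * g (n + j)%N.
have TE n : (n < M)%N ->
    T n = \sum_(0 <= i < M) normsum a i * g i * ent i n.
  move=> nM; rewrite /T (@big_cat_nat _ _ _ (M - n)%N 0 M)//= ?leq_subr//.
  rewrite [X in _ + X]big_nat [X in _ + X]big1 ?addr0; last first.
    by move=> j /andP[j1 _]; rewrite gM ?mulr0//; lia.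
  rewrite (@big_cat_nat _ _ _ n 0 M)//=; last exact: ltnW.
  rewrite [X in _ = X + _]big_nat [X in _ = X + _]big1 ?add0r; last first.
    by move=> i /andP[_ iN]; rewrite /ent leqNgt iN /= mulr0.
  have := big_addn 0 M n xpredT (fun i => normsum a i * g i * ent i n).
  rewrite add0n => ->; apply: eq_bigr => j _.
  rewrite /ent leq_addl addnK addnC.
  (* Multiplying and dividing by [normsum] cancels unless it is 0; in that case [a j], one of its
     terms, is 0 as well. *)
  have [B0|Bn0] := eqVneq (normsum a (j + n)) 0; last by field.
  rewrite B0 !mul0r; have := normc_le_normsum (leq_addr n j).
  rewrite B0 => a0; suff -> : normc (a j) = 0 by rewrite mul0r.
  by apply/eqP; rewrite eq_le a0 normc_ge0.
set X := (X in X <= _); set G := (X in _ <= _ * X).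
have X0 : 0 <= X by apply: sumr_ge0 => i _; exact: sqr_ge0.
have G0 : 0 <= G by apply: sumr_ge0 => i _; rewrite mulr_ge0// sqr_ge0.
(* Duality: the square norm of [T] is the pairing of [T] with the adjoint image of [A g], that is,
   of [A g] with the image of [T] under the matrix. Cauchy-Schwarz and the bound on the matrix then
   give [X^2 <= G C^2 X], from which a nonzero [X] cancels. *)
have XE : X = \sum_(0 <= i < M) (normsum a i * g i) *
              (\sum_(0 <= n < M) ent i n * T n).
  under [RHS]eq_bigr do rewrite mulr_sumr.
  rewrite exchange_big /= /X [LHS]big_nat [RHS]big_nat; apply: eq_bigr => n /andP[_ nM].
  rewrite -/(T n) expr2 {1}(TE _ nM) mulr_suml; apply: eq_bigr => i _.
  by rewrite mulrA.
have : X ^+ 2 <= G * (C ^+ 2 * X).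
  rewrite {1}XE; apply: le_trans (Cauchy_Schwarz_sum _ _ _) _.
  have -> : \sum_(0 <= i < M) (normsum a i * g i) ^+ 2 = G.
    by apply: eq_bigr => i _; rewrite exprMn.
  by apply: ler_wpM2l => //; exact: HC.
have [->|Xn0] := eqVneq X 0; first by move=> _; rewrite mulr_ge0// sqr_ge0.
by rewrite mulrA expr2 ler_pM2r ?lt_def ?Xn0// mulrC.
Qed.

End AdjointNorlund.

(** * Quasi-orthogonality of dyadic blocks *)

Section HilbertSeminorm.
Variable R : realType.

(* [Q] is the square of the seminorm of a semi-inner product, whose polarisation
   is only recorded along real lines. *)
Definition hilbert_seminorm_sq (V : lmodType R[i]) (Q : V -> R) : Prop :=
  [/\ forall x, 0 <= Q x,
      forall c x, Q (c *: x) = normc c ^+ 2 * Q x &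
      forall x y, exists b, forall t : R,
        Q (x + t%:C%C *: y) = Q x + t * b + t ^+ 2 * Q y].

Section Triangle.
Variables (V : lmodType R[i]) (Q : V -> R).
Hypothesis hQ : hilbert_seminorm_sq Q.

Lemma hilbert_seminorm_ge0 x : 0 <= Q x. Proof. by case: hQ. Qed.

(** The real polynomial [t |-> Q (x + t y)] is nonnegative, so its discriminant yields the
    Cauchy-Schwarz bound on the cross term [b]; then take [t = 1]. *)
Lemma hilbert_seminormD x y :
  Q (x + y) <= (Num.sqrt (Q x) + Num.sqrt (Q y)) ^+ 2.
Proof.
case: hQ => Q0 _ /(_ x y) [b Hb].
have : b ^+ 2 <= 4 * Q x * Q y.
  by apply: quadratic_ge0_discr => // t; rewrite -Hb.
rewrite -{1}(sqr_sqrtr (Q0 x)) -{1}(sqr_sqrtr (Q0 y)).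
have := Hb 1; rewrite scale1r mul1r expr1n mul1r => ->.
rewrite -{2}(sqr_sqrtr (Q0 x)) -{2}(sqr_sqrtr (Q0 y)).
have := sqrtr_ge0 (Q x); have := sqrtr_ge0 (Q y).
set u := Num.sqrt (Q x); set v := Num.sqrt (Q y) => v0 u0 b2.
suff : b <= 2 * (u * v) by nra.
apply: le_trans (ler_norm b) _.
rewrite -(ler_pXn2r (n := 2))// ?nnegrE ?mulr_ge0// real_normK ?num_real//.
by apply: le_trans b2 _; rewrite le_eqVlt; apply/orP; left; apply/eqP; ring.
Qed.

Lemma hilbert_seminorm_sum (I : Type) (r : seq I) (c : I -> R[i]) (x : I -> V) :
  Q (\sum_(i <- r) c i *: x i) <=
  (\sum_(i <- r) normc (c i) * Num.sqrt (Q (x i))) ^+ 2.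
Proof.
have [Q0 QZ _] := hQ.
elim: r => [|i r IH].
  rewrite !big_nil -(scale0r (0 : V)) QZ.
  by rewrite (normc0 R) expr0n /= mul0r.
rewrite !big_cons; apply: le_trans (hilbert_seminormD _ _) _.
have S0 : 0 <= \sum_(i <- r) normc (c i) * Num.sqrt (Q (x i)).
  by apply: sumr_ge0 => j _; rewrite mulr_ge0 ?normc_ge0 ?sqrtr_ge0.
rewrite ler_pXn2r// ?nnegrE ?addr_ge0 ?mulr_ge0 ?normc_ge0 ?sqrtr_ge0//.
apply: lerD.
  by rewrite QZ sqrtrM ?sqr_ge0// sqrtr_sqr ger0_norm ?normc_ge0.
rewrite -(ler_pXn2r (n := 2))// ?nnegrE ?sqrtr_ge0//.
by rewrite sqr_sqrtr.
Qed.

(** Cross terms subtract, and contractivity is exactly positivity of the difference. This makes the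
    triangle inequality available for the defect. *)
Lemma hilbert_seminorm_defect (L : V -> V) :
  (forall c, {morph L : x / c *: x}) -> {morph L : x y / x + y} ->
  (forall x, Q (L x) <= Q x) -> hilbert_seminorm_sq (fun x => Q x - Q (L x)).
Proof.
have [Q0 QZ QD] := hQ => LZ LD QL; split => [x|c x|x y].
- by rewrite subr_ge0.
- by rewrite LZ !QZ mulrBr.
- have [b Hb] := QD x y; have [b' Hb'] := QD (L x) (L y).
  exists (b - b') => t; rewrite LD LZ Hb Hb'; ring.
Qed.

End Triangle.

Section PolynomialOrbit.
Variable N : {poly R[i]} -> R.
Hypotheses (hN : hilbert_seminorm_sq N) (NX : forall p, N ('X * p) <= N p).

Let Q p := N p - N ('X * p).

Let hQ : hilbert_seminorm_sq Q.
Proof.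
apply: hilbert_seminorm_defect => // [c p|p q]; first by rewrite -scalerAr.
by rewrite mulrDr.
Qed.

Let Q_ge0 p : 0 <= Q p. Proof. exact: hilbert_seminorm_ge0. Qed.
Let N_ge0 p : 0 <= N p. Proof. exact: hilbert_seminorm_ge0. Qed.

Lemma orbit_norm_nonincr i j : (i <= j)%N -> N 'X^j <= N 'X^i.
Proof.
move/subnK <-; elim: (j - i)%N => // k IH; rewrite addSn exprS.
exact: le_trans (NX _) IH.
Qed.

Let defect_expansion p K :
  N p = \sum_(0 <= n < K) Q ('X^n * p) + N ('X^K * p).
Proof.
elim: K => [|K IH]; first by rewrite big_nil add0r mul1r.
by rewrite big_nat_recr //= -addrA {2}/Q mulrA -exprS subrK.
Qed.

(** The quantity [psi n] stays constant while [n + j < M] and afterwards drops by exactly the defect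
    at [n + j], so the sum telescopes from [psi 0], which is [N 'X^M] because [j <= M]. *)
Let tail_defect M j : (j <= M)%N ->
  \sum_(0 <= n < M) (if (M <= n + j)%N then Q 'X^(n + j) else 0) <= N 'X^M.
Proof.
move=> jM; pose psi n := N 'X^(maxn (n + j) M).
have E n : (if (M <= n + j)%N then Q 'X^(n + j) else 0) = psi n - psi n.+1.
  rewrite /psi; case: leqP => h.
    by rewrite /Q -exprS -addSn; congr (_ - N 'X^_); lia.
  by rewrite (maxn_idPr _) ?subrr//; lia.
under eq_bigr do rewrite E.
rewrite (eq_bigr (fun n => - (psi n.+1 - psi n))) => [|i _]; last by rewrite opprB.
rewrite sumrN telescope_sumr// opprB /psi add0n (maxn_idPr jM).
by rewrite gerBl N_ge0.
Qed.

Section Block.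
Variable a : nat -> R[i].
Hypothesis ha : norlund_bounded (fun n => (normc (a n))%:C%C).

(* With g_i the defect seminorm of P^i f, the square norm of the block is the
   sum over n < M of the defects of P^n(block), each controlled by
   sum_j |a_j| g_(n+j): the indices n + j < M are handled by the adjoint of the
   Norlund matrix, those beyond M by |P^M f|. *)
Lemma orbit_block_norm :
  exists2 C : R, 0 <= C & forall m M, (m <= M)%N ->
  N (\sum_(m <= j < M) a j *: 'X^j) <=
  C * \sum_(m <= i < M) normsum a i ^+ 2 * (N 'X^i - N 'X^(i.+1)) +
  3 * (\sum_(0 <= j < M) normc (a j)) ^+ 2 * N 'X^M.
Proof.
have [C HC] := adjoint_norlund_bound ha.
(* The 2 comes from [(T + U)^2 <= 2 T^2 + 2 U^2]. The 3 in the statement is this 2, for the [U]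
   part, plus 1 for the remainder [|P^M S|^2]. *)
exists (2 * C ^+ 2) => [|m M mM]; first by rewrite mulr_ge0// sqr_ge0.
set S := \sum_(m <= j < M) _ *: _; set A := \sum_(0 <= j < M) normc _.
pose g i := Num.sqrt (Q 'X^i).
have g_ge0 i : 0 <= g i by exact: sqrtr_ge0.
(* Block indices satisfy [m <= j], hence [m <= n + j]. Cutting [g] below [m] loses nothing on the
   block and makes the adjoint bound, whose sums start at 0, charge only indices in [[m, M)]. *)
pose g1 i := if (m <= i < M)%N then g i else 0.
pose g2 i := if (M <= i)%N then g i else 0.
have g1_ge0 i : 0 <= g1 i by rewrite /g1; case: ifP.
have g2_ge0 i : 0 <= g2 i by rewrite /g2; case: ifP.
pose T n := \sum_(0 <= j < M) normc (a j) * g1 (n + j)%N.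
pose U n := \sum_(0 <= j < M) normc (a j) * g2 (n + j)%N.
have A0 : 0 <= A by apply: sumr_ge0 => j _; exact: normc_ge0.
have QS n : Q ('X^n * S) <= 2 * T n ^+ 2 + 2 * U n ^+ 2.
  rewrite mulr_sumr; under eq_bigr do rewrite -scalerAr -exprD.
  apply: le_trans (hilbert_seminorm_sum hQ _ _ _) _.
  have : \sum_(m <= j < M) normc (a j) * g (n + j)%N <= T n + U n.
    rewrite /T /U -big_split /= (@big_cat_nat _ _ _ m 0 M)//=.
    apply: ler_wpDl.
      by apply: sumr_ge0 => j _; rewrite addr_ge0// mulr_ge0// normc_ge0.
    rewrite big_nat [leRHS]big_nat; apply: ler_sum => j /andP[mj jM].
    rewrite -mulrDr ler_wpM2l ?normc_ge0// /g1 /g2.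
    have -> : (m <= n + j)%N by lia.
    by case: ltnP => //= _; rewrite ?addr0 ?add0r.
  have : 0 <= \sum_(m <= j < M) normc (a j) * g (n + j)%N.
    by apply: sumr_ge0 => j _; rewrite mulr_ge0// normc_ge0.
  rewrite -/(g _); set s := \sum_(m <= j < M) _ => s0 sTU.
  have : s ^+ 2 <= (T n + U n) ^+ 2.
    by rewrite ler_pXn2r// nnegrE//; exact: le_trans sTU.
  by have := sqr_ge0 (T n - U n); nra.
have HT : \sum_(0 <= n < M) T n ^+ 2 <=
    C ^+ 2 * \sum_(m <= i < M) normsum a i ^+ 2 * (N 'X^i - N 'X^(i.+1)).
  have g1M i : (M <= i)%N -> g1 i = 0 by rewrite /g1 ltnNge => ->; rewrite andbF.
  apply: le_trans (HC g1 M g1M) _.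
  rewrite (@big_cat_nat _ _ _ m 0 M)//= [X in X + _]big_nat big1 ?add0r.
    rewrite big_nat [X in _ <= _ * X]big_nat ler_wpM2l ?sqr_ge0//.
    apply: ler_sum => i iM; rewrite /g1 iM sqr_sqrtr//.
    by rewrite /Q -exprS.
  by move=> i /andP[_ im]; rewrite /g1 leqNgt im /= expr0n mulr0.
have HU : \sum_(0 <= n < M) U n ^+ 2 <= A ^+ 2 * N 'X^M.
  apply: (@le_trans _ _ (\sum_(0 <= n < M)
    A * \sum_(0 <= j < M) normc (a j) * g2 (n + j)%N ^+ 2)).
    apply: ler_sum => n _; apply: weighted_Cauchy_Schwarz => j.
    exact: normc_ge0.
  rewrite -mulr_sumr exchange_big /= expr2 -mulrA ler_wpM2l//.
  rewrite mulr_suml big_nat [leRHS]big_nat; apply: ler_sum => j /andP[_ jM].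
  rewrite -mulr_sumr ler_wpM2l ?normc_ge0//.
  apply: le_trans (tail_defect (ltnW jM)).
  apply: ler_sum => n _; rewrite /g2; case: ifP => _; last by rewrite expr0n.
  by rewrite sqr_sqrtr.
have HN : N ('X^M * S) <= A ^+ 2 * N 'X^M.
  rewrite mulr_sumr; under eq_bigr do rewrite -scalerAr -exprD.
  apply: le_trans (hilbert_seminorm_sum hN _ _ _) _.
  rewrite -(sqr_sqrtr (N_ge0 'X^M)) -exprMn ler_pXn2r// ?nnegrE.
  - rewrite mulr_suml; apply: (@le_trans _ _
      (\sum_(m <= j < M) normc (a j) * Num.sqrt (N 'X^M))).
      apply: ler_sum => j _; rewrite ler_wpM2l ?normc_ge0// ler_wsqrtr//.
      by apply: orbit_norm_nonincr; rewrite leq_addr.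
    rewrite (@big_cat_nat _ _ _ m 0 M)//= lerDr.
    by apply: sumr_ge0 => j _; rewrite mulr_ge0 ?normc_ge0 ?sqrtr_ge0.
  - by apply: sumr_ge0 => j _; rewrite mulr_ge0 ?normc_ge0 ?sqrtr_ge0.
  - by rewrite mulr_ge0 ?sqrtr_ge0.
have : \sum_(0 <= n < M) Q ('X^n * S) <=
    2 * \sum_(0 <= n < M) T n ^+ 2 + 2 * \sum_(0 <= n < M) U n ^+ 2.
  by rewrite !mulr_sumr -big_split /=; apply: ler_sum.
rewrite (defect_expansion S M); lra.
Qed.

(** On [[2^n, 2^(n+1))] the weights are replaced by their value at [2^(n+1)] and the defects
    telescope. The boundary term at [M = 2^q] is absorbed by the summand [n = q - 1], which adds 3
    to the constant; for [p = q] there is no such summand, but the block is empty. *)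
Lemma orbit_dyadic_block_norm :
  exists2 C : R, 0 <= C & forall p q, (p <= q)%N ->
  N (\sum_(2 ^ p <= j < 2 ^ q) a j *: 'X^j) <=
  C * \sum_(p <= n < q) normsum a (2 ^ n.+1) ^+ 2 * N 'X^(2 ^ n).
Proof.
have [C C0 HC] := orbit_block_norm; exists (C + 3) => [|p q pq].
  by rewrite addr_ge0.
pose E n := normsum a (2 ^ n.+1) ^+ 2 * N 'X^(2 ^ n).
have E0 n : 0 <= E n by rewrite mulr_ge0// sqr_ge0.
have H1 : \sum_(2 ^ p <= i < 2 ^ q) normsum a i ^+ 2 * (N 'X^i - N 'X^(i.+1))
    <= \sum_(p <= n < q) E n.
  move/subnK: (pq) => <-; elim: (q - p)%N => [|k IH].
    by rewrite add0n !big_geq.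
  rewrite addSn (@big_cat_nat _ _ _ (2 ^ (k + p)))//=; first last.
  - by rewrite leq_exp2l.
  - by rewrite leq_exp2l// leq_addl.
  rewrite big_nat_recr ?leq_addl//=; apply: lerD => //.
  apply: (@le_trans _ _ (\sum_(2 ^ (k + p) <= i < 2 ^ (k + p).+1)
     normsum a (2 ^ (k + p).+1) ^+ 2 * (N 'X^i - N 'X^(i.+1)))).
    rewrite big_nat [leRHS]big_nat; apply: ler_sum => i /andP[_ /ltnW ik].
    rewrite ler_wpM2r ?subr_ge0 ?orbit_norm_nonincr//.
    by rewrite ler_pXn2r ?nnegrE ?normsum_ge0 ?normsum_mono.
  rewrite -mulr_sumr ler_wpM2l ?sqr_ge0//.
  under eq_bigr do rewrite -opprB.
  by rewrite sumrN telescope_sumr ?leq_exp2l// opprB gerBl N_ge0.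
have [pE|pltq] := eqVneq p q.
  by rewrite pE !big_geq// -(scale0r (0 : {poly R[i]})); case: hN => _ -> _;
     rewrite (normc0 R) expr0n /= mul0r mulr0.
have {}pltq : (p < q)%N by rewrite ltn_neqAle pltq.
have H2 : (\sum_(0 <= j < 2 ^ q) normc (a j)) ^+ 2 * N 'X^(2 ^ q) <=
    \sum_(p <= n < q) E n.
  case: q pltq {pq H1} => // q pq.
  rewrite big_nat_recr //= -[leLHS]add0r; apply: lerD; first exact: sumr_ge0.
  apply: ler_pM => //; first exact: sqr_ge0.
    rewrite ler_pXn2r ?nnegrE ?normsum_ge0//; last first.
      by apply: sumr_ge0 => j _; exact: normc_ge0.
    rewrite /normsum -(big_mkord xpredT (fun k => normc (a k))).
    by apply: sum_nat_mono => // i; exact: normc_ge0.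
  by apply: orbit_norm_nonincr; rewrite leq_exp2l.
apply: (le_trans (HC (2 ^ p)%N (2 ^ q)%N _)); first by rewrite leq_exp2l.
by rewrite -mulrA [leRHS]mulrDl; apply: lerD; apply: ler_wpM2l.
Qed.

End Block.
End PolynomialOrbit.
End HilbertSeminorm.

(** * The Rademacher-Menshov maximal inequality *)

Section Dominated.
Variables (R : realType) (d : measure_display) (Y : measurableType d)
  (m : {measure set Y -> \bar R}).

(** Maximal inequalities over finite ranges are stated through a real-valued majorant [G], so that
    suprema, with their measurability and possible infinite values, enter only at the end. *)
Definition dominated (G : Y -> R) (c : R) : Prop :=
  [/\ measurable_fun setT G, forall x, 0 <= G x &
      (\int[m]_x (G x)%:E <= c%:E)%E].

Lemma dominatedW G c c' : c <= c' -> dominated G c -> dominated G c'.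
Proof.
move=> cc' [mG G0 Gc]; split => //; apply: le_trans Gc _.
by rewrite lee_fin.
Qed.

Lemma dominated0 : dominated (fun=> 0) 0.
Proof. by split=> //; rewrite integral0. Qed.

Lemma dominatedD G c H c' : dominated G c -> dominated H c' ->
  dominated (fun x => G x + H x) (c + c').
Proof.
move=> [mG G0 Gc] [mH H0 Hc]; split.
- exact: measurable_funD.
- by move=> x; rewrite addr_ge0.
- under eq_integral do rewrite EFinD.
  rewrite ge0_integralD//; [|by move=> x _; rewrite lee_fin
    |exact/measurable_EFinP|by move=> x _; rewrite lee_fin
    |exact/measurable_EFinP].
  by rewrite EFinD leeD.
Qed.

Lemma dominatedZ k G c : 0 <= k -> dominated G c ->
  dominated (fun x => k * G x) (k * c).
Proof.
move=> k0 [mG G0 Gc]; split.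
- exact: measurable_funM.
- by move=> x; rewrite mulr_ge0.
- under eq_integral do rewrite EFinM.
  rewrite ge0_integralZl_EFin//; [|by move=> x _; rewrite lee_fin
    |exact/measurable_EFinP].
  by rewrite EFinM lee_wpmul2l// lee_fin.
Qed.

Lemma dominated_sum (a b : nat) (G : nat -> Y -> R) (c : nat -> R) :
  (forall k, (a <= k < b)%N -> dominated (G k) (c k)) ->
  dominated (fun x => \sum_(a <= k < b) G k x) (\sum_(a <= k < b) c k).
Proof.
have [ab|/ltnW ba] := leqP a b; last first.
  move=> _; rewrite big_geq//; under eq_fun do rewrite big_geq//.
  exact: dominated0.
move/subnK: ab => <-; elim: (b - a)%N => [_|k IH H].
  rewrite add0n big_geq//; under eq_fun do rewrite big_geq//.
  exact: dominated0.
rewrite addSn big_nat_recr ?leq_addl//=.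
under eq_fun do rewrite big_nat_recr ?leq_addl//=.
apply: dominatedD; first by apply: IH => i ?; apply: H; lia.
by apply: H; lia.
Qed.

End Dominated.

Lemma nat_sum_ge_term (R : realType) (a b k : nat) (F : nat -> R) :
  (forall i, 0 <= F i) -> (a <= k < b)%N -> F k <= \sum_(a <= i < b) F i.
Proof.
move=> F0 kab; rewrite (bigD1_seq k) ?mem_index_iota ?iota_uniq//=.
by rewrite lerDl sumr_ge0.
Qed.

Lemma sum_dyadic (R : realType) (a K : nat) (F : nat -> R) : (a <= K)%N ->
  \sum_(2 ^ a <= n < 2 ^ K) F n =
  \sum_(a <= k < K) \sum_(2 ^ k <= n < 2 ^ k.+1) F n.
Proof.
move/subnK <-; elim: (K - a)%N => [|i IH]; first by rewrite add0n !big_geq.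
rewrite addSn big_nat_recr ?leq_addl//= -IH -big_cat_nat//= leq_exp2l//.
exact: leq_addl.
Qed.

Section RademacherMenshov.
Variables (R : realType) (d : measure_display) (Y : measurableType d)
  (m : {measure set Y -> \bar R}).
Variables (S : nat -> Y -> R[i]) (w : nat -> R).
Hypothesis w_ge0 : forall n, 0 <= w n.
Hypothesis hS : forall p q, (p <= q)%N ->
  dominated m (fun x => normc (S q x - S p x) ^+ 2) (\sum_(p <= n < q) w n).

(* Halving [p, p + 2^(l+1)] and using (b + c)^2 <= (1 + 1/k) b^2 + (1 + k) c^2
   with k = l + 1 makes the constants (l + 1)^2 propagate exactly. *)
Lemma Rademacher_Menshov_block l p : exists2 G : Y -> R,
  dominated m G (l.+1%:R ^+ 2 * \sum_(p <= n < p + 2 ^ l) w n) &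
  forall n x, (p <= n <= p + 2 ^ l)%N -> normc (S n x - S p x) ^+ 2 <= G x.
Proof.
elim: l p => [|l IH] p.
  exists (fun x => normc (S (p + 1) x - S p x) ^+ 2).
    by rewrite expr1n mul1r; apply: hS; rewrite leq_addr.
  move=> n x; rewrite expn0 => pn.
  have [->|->] : n = p \/ n = (p + 1)%N by lia.
    by rewrite subrr (normc0 R) expr0n sqr_ge0.
  by [].
have [G1 hG1 HG1] := IH p; have [G2 hG2 HG2] := IH (p + 2 ^ l)%N.
have hD : (p <= p + 2 ^ l)%N by rewrite leq_addr.
have {}hD := hS hD.
set k : R := l.+1%:R in hG1 hG2; have k0 : 0 < k by rewrite ltr0n.
exists (fun x => (1 + k^-1) * (G1 x + G2 x) +
                 (1 + k) * normc (S (p + 2 ^ l) x - S p x) ^+ 2).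
  have kV0 : 0 <= 1 + k^-1 by rewrite addr_ge0// invr_ge0 ltW.
  have k10 : 0 <= 1 + k by rewrite addr_ge0// ltW.
  apply: dominatedW (dominatedD (dominatedZ kV0 (dominatedD hG1 hG2))
                      (dominatedZ k10 hD)).
  have -> : (p + 2 ^ l.+1 = p + 2 ^ l + 2 ^ l)%N by rewrite expnS; lia.
  rewrite [X in _ <= _ * X](@big_cat_nat _ _ _ (p + 2 ^ l)) ?leq_addr//=.
  set W1 := \sum_(p <= n < _) w n; set W2 := \sum_(_ <= n < _ + _ + _) w n.
  have W20 : 0 <= W2 by apply: sumr_ge0.
  have -> : l.+2%:R = k + 1 by rewrite /k natr1.
  (* The middle increment adds [(1 + k) W1], so [W1] receives exactly [(k + 1)^2] and [W2] receives
     [k^2 + k], which is less. *)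
  have -> : (1 + k^-1) * (k ^+ 2 * W1 + k ^+ 2 * W2) =
            (k ^+ 2 + k) * (W1 + W2) by field; rewrite gt_eqF.
  by have := mulr_ge0 (ltW k0) W20; nra.
move=> n x pn; clearbody k.
have G10 : 0 <= G1 x by case: hG1.
have G20 : 0 <= G2 x by case: hG2.
have kV0 : 0 < k^-1 by rewrite invr_gt0.
set D := normc (S (p + 2 ^ l) x - S p x).
have [np|np] := leqP n (p + 2 ^ l).
  have : normc (S n x - S p x) ^+ 2 <= G1 x by apply: HG1; lia.
  have : 0 <= (1 + k) * D ^+ 2 by rewrite mulr_ge0 ?sqr_ge0// addr_ge0// ltW.
  have : 0 <= k^-1 * (G1 x + G2 x) by rewrite mulr_ge0 ?addr_ge0// ltW.
  lra.
have HB : normc (S n x - S (p + 2 ^ l) x) ^+ 2 <= G2 x.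
  by apply: HG2; rewrite expnS in pn; lia.
have : normc (S n x - S p x) <= normc (S n x - S (p + 2 ^ l) x) + D.
  by apply: le_trans (ler_normcD _ _); rewrite addrA subrK.
move: HB; set B := normc (S n x - S (p + 2 ^ l) x); set z := normc _ => HB zB.
have B0 : 0 <= B by exact: normc_ge0.
have D0 : 0 <= D by exact: normc_ge0.
apply: (@le_trans _ _ ((B + D) ^+ 2)).
  by rewrite ler_pXn2r// nnegrE ?normc_ge0// addr_ge0.
have : 0 <= k^-1 * (B - k * D) ^+ 2 by rewrite mulr_ge0 ?sqr_ge0// ltW.
have -> : k^-1 * (B - k * D) ^+ 2 = k^-1 * B ^+ 2 - 2 * B * D + k * D ^+ 2.
  by field; rewrite gt_eqF.
have := ler_wpM2l (ltW kV0) HB; have : 0 <= k^-1 * G1 x by rewrite mulr_ge0// ltW.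
lra.
Qed.

(** For n in the k-th dyadic block, [S n - S (2^a)] is split through [S (2^K)] and [S (2^k)].
    Comparing [S (2^k)] with the far end [2^K] avoids a second maximal inequality: the squares of
    these differences can be summed over k, since each [w n] then occurs at most as often as there
    are earlier blocks, which the squared weight pays for. *)
Lemma Rademacher_Menshov (t : nat -> R) a K : (a <= K)%N ->
  (forall k n, (2 ^ k <= n < 2 ^ k.+1)%N -> k.+1%:R ^+ 2 * w n <= t n) ->
  exists2 G : Y -> R,
    dominated m G (12 * \sum_(2 ^ a <= n < 2 ^ K) t n) &
    forall n x, (2 ^ a <= n <= 2 ^ K)%N ->
      normc (S n x - S (2 ^ a)%N x) ^+ 2 <= G x.
Proof.
move=> aK ht; pose T k := S (2 ^ k)%N.
pose W k := \sum_(2 ^ k <= n < 2 ^ k.+1) w n.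
have W0 k : 0 <= W k by exact: sumr_ge0.
have /choice[E HE] : forall k, exists G, dominated m G (k.+1%:R ^+ 2 * W k) /\
    forall n x, (2 ^ k <= n <= 2 ^ k.+1)%N -> normc (S n x - T k x) ^+ 2 <= G x.
  move=> k; have [G] := Rademacher_Menshov_block k (2 ^ k)%N.
  by rewrite addnn -mul2n -expnS; exists G.
have E0 k x : 0 <= E k x by case: (HE k) => -[].
pose V := \sum_(a <= k < K) k.+1%:R ^+ 2 * W k.
have WV : \sum_(2 ^ a <= n < 2 ^ K) w n +
    \sum_(a <= k < K) \sum_(2 ^ k <= n < 2 ^ K) w n <= 2 * V.
  have W1 k : W k <= k.+1%:R ^+ 2 * W k.
    by apply: ler_peMl => //; rewrite -natrX ler1n expn_gt0.
  have : \sum_(2 ^ a <= n < 2 ^ K) w n <= V.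
    by rewrite sum_dyadic//; apply: ler_sum => k _; exact: W1.
  suff : \sum_(a <= k < K) \sum_(2 ^ k <= n < 2 ^ K) w n <= V by lra.
  rewrite /V; move/subnK: aK => <-; elim: (K - a)%N => [|i IH].
    by rewrite add0n !big_geq.
  rewrite addSn big_nat_recr ?leq_addl//= [leRHS]big_nat_recr ?leq_addl//=.
  rewrite -/(W _).
  (* The new block lies in the tails of all k from [a] to [i + a]: [W (i + a)] enters [i + 1] times,
     at most the [(i + a + 1)^2] allowed. *)
  have -> : \sum_(a <= k < i + a) \sum_(2 ^ k <= n < 2 ^ (i + a).+1) w n =
      \sum_(a <= k < i + a) \sum_(2 ^ k <= n < 2 ^ (i + a)) w n +
      i%:R * W (i + a)%N.
    rewrite -[in i%:R](addnK a i) mulr_natl -sumr_const_nat -big_split /=.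
    rewrite big_nat [RHS]big_nat; apply: eq_bigr => k /andP[_ /ltnW ki].
    by rewrite -big_cat_nat//= leq_exp2l.
  rewrite -addrA; apply: lerD => //.
  rewrite -[X in _ + X]mul1r -mulrDl ler_wpM2r// natr1.
  rewrite -natrX ler_nat; nia.
have Vt : V <= \sum_(2 ^ a <= n < 2 ^ K) t n.
  rewrite sum_dyadic//; apply: ler_sum => k _.
  by rewrite mulr_sumr big_nat [leRHS]big_nat; apply: ler_sum => n /ht.
(* The coefficients come from [(u + (v + s))^2 <= 2 u^2 + 4 v^2 + 4 s^2]. By [WV] the integral is at
   most [4 (2 V) + 4 V = 12 V]. *)
exists (fun x => 2 * normc (T K x - T a x) ^+ 2 +
   4 * \sum_(a <= k < K) (normc (T K x - T k x) ^+ 2 + E k x)).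
  apply: (@dominatedW _ _ _ _ _ (2 * \sum_(2 ^ a <= n < 2 ^ K) w n +
     4 * \sum_(a <= k < K) (\sum_(2 ^ k <= n < 2 ^ K) w n + k.+1%:R ^+ 2 * W k))).
    rewrite big_split /= -/V.
    have : 0 <= \sum_(2 ^ a <= n < 2 ^ K) w n by exact: sumr_ge0.
    lra.
  apply: dominatedD.
    by apply: dominatedZ => //; apply: hS; rewrite leq_exp2l.
  apply: dominatedZ => //; apply: dominated_sum => k /andP[ak kK].
  apply: dominatedD; last by case: (HE k).
  by apply: hS; rewrite leq_exp2l// ltnW.
move=> n x /andP[an nK].
have F0 k : 0 <= normc (T K x - T k x) ^+ 2 + E k x by rewrite addr_ge0 ?sqr_ge0.
have [->|nltK] := eqVneq n (2 ^ K)%N.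
  rewrite -/(T K) -/(T a).
  have : 0 <= \sum_(a <= k < K) (normc (T K x - T k x) ^+ 2 + E k x).
    by apply: sumr_ge0.
  by have := sqr_ge0 (normc (T K x - T a x)); lra.
have {nltK} nK' : (n < 2 ^ K)%N by rewrite ltn_neqAle nltK.
pose k := trunc_log 2 n.
have n0 : (0 < n)%N by apply: leq_trans an; rewrite expn_gt0.
have /andP[kn nk] := @trunc_log_bounds 2 n isT n0; rewrite -/k in kn nk.
have ak : (a <= k)%N.
  by rewrite -ltnS -(@ltn_exp2l 2)//; exact: leq_ltn_trans nk.
have kK : (k < K)%N.
  by rewrite -(@ltn_exp2l 2)//; exact: leq_ltn_trans nK'.
have := @nat_sum_ge_term _ a K k _ F0; rewrite ak kK => /(_ isT).
have : normc (S n x - T k x) ^+ 2 <= E k x.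
  by case: (HE k) => _; apply; rewrite kn ltnW.
have : normc (S n x - T a x) <=
    normc (T K x - T a x) + (normc (T K x - T k x) + normc (S n x - T k x)).
  have -> : S n x - T a x = (T K x - T a x) + ((T k x - T K x) + (S n x - T k x)).
    by ring.
  apply: le_trans (ler_normcD _ _) _; rewrite lerD2l.
  by apply: le_trans (ler_normcD _ _) _; rewrite normcB.
move: (normc_ge0 (S n x - T a x)) (normc_ge0 (T K x - T a x)).
move: (normc_ge0 (T K x - T k x)) (normc_ge0 (S n x - T k x)).
rewrite -/(T a).
set z := normc (S n x - T a x); set u := normc (T K x - T a x).
set v := normc (T K x - T k x); set s := normc (S n x - T k x).
move=> v0 s0 z0 u0 zuvs sE; set X := \sum_(_ <= _ < _) _ => X1.
apply: (@le_trans _ _ ((u + (v + s)) ^+ 2)).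
  by rewrite ler_pXn2r// nnegrE ?addr_ge0.
have := sqr_ge0 (u - (v + s)); have := sqr_ge0 (v - s); nra.
Qed.

End RademacherMenshov.

(** * Polynomials in a contraction of L2 *)

Section SquareIntegrable.
Variables (R : realType) (d : measure_display) (Y : measurableType d)
  (m : {measure set Y -> \bar R}).
Implicit Types g h : Y -> R[i].

Lemma measurable_sqr_normc g :
  Cmeasurable g -> measurable_fun setT (fun x => normc (g x) ^+ 2).
Proof.
move=> [mR mI]; under eq_fun do rewrite sqr_normc_ReIm.
by apply: measurable_funD; apply: measurable_funX.
Qed.

Lemma CmeasurableD g h : Cmeasurable g -> Cmeasurable h ->
  Cmeasurable (fun x => g x + h x).
Proof.
move=> [gR gI] [hR hI]; split.
  by under eq_fun do rewrite ReD; exact: measurable_funD.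
by under eq_fun do rewrite ImD; exact: measurable_funD.
Qed.

Lemma CmeasurableZ c g : Cmeasurable g -> Cmeasurable (fun x => c * g x).
Proof.
move=> [gR gI]; split.
  under eq_fun do rewrite ReM.
  by apply: measurable_funB; apply: measurable_funM.
under eq_fun do rewrite ImM.
by apply: measurable_funD; apply: measurable_funM.
Qed.

Lemma dominated_inL2 g c : Cmeasurable g ->
  dominated m (fun x => normc (g x) ^+ 2) c -> inL2 m g.
Proof. by move=> mg [_ _ gc]; split=> //; apply: le_lt_trans gc _; rewrite ltry. Qed.

Lemma L2sq_ge0 g : (0 <= L2sq m g)%E.
Proof. by apply: integral_ge0 => x _; rewrite lee_fin sqr_ge0. Qed.

Lemma L2sq_fin g : inL2 m g -> L2sq m g = (fine (L2sq m g))%:E.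
Proof. by move=> [_ gf]; rewrite fineK// ge0_fin_numE// L2sq_ge0. Qed.

Lemma inL2_dominated g : inL2 m g ->
  dominated m (fun x => normc (g x) ^+ 2) (fine (L2sq m g)).
Proof.
move=> hg; split=> [|x|]; last by rewrite -L2sq_fin.
  by apply: measurable_sqr_normc; case: hg.
exact: sqr_ge0.
Qed.

Lemma inL2Z c g : inL2 m g -> inL2 m (fun x => c * g x).
Proof.
move=> hg; have [mg _] := hg.
apply: (dominated_inL2 (CmeasurableZ c mg)).
under eq_fun do rewrite normcM exprMn.
by apply: dominatedZ (inL2_dominated hg); rewrite sqr_ge0.
Qed.

Lemma dominated_le (G H : Y -> R) c : measurable_fun setT G ->
  (forall x, 0 <= G x <= H x) -> dominated m H c -> dominated m G c.
Proof.
move=> mG GH [mH H0 Hc]; split=> // [x|]; first by case/andP: (GH x).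
apply: le_trans Hc; apply: ge0_le_integral => //.
- by move=> x _; rewrite lee_fin; case/andP: (GH x).
- exact/measurable_EFinP.
- exact/measurable_EFinP.
- by move=> x _; rewrite lee_fin; case/andP: (GH x).
Qed.

Lemma inL2D g h : inL2 m g -> inL2 m h -> inL2 m (fun x => g x + h x).
Proof.
move=> hg hh; have [mg _] := hg; have [mh _] := hh.
have mgh := CmeasurableD mg mh.
apply: (dominated_inL2 mgh).
apply: dominated_le (measurable_sqr_normc mgh) _
  (dominatedZ (ler0n R 2) (dominatedD (inL2_dominated hg) (inL2_dominated hh))).
move=> x; rewrite sqr_ge0 /=.
apply: (@le_trans _ _ ((normc (g x) + normc (h x)) ^+ 2)).
  by rewrite ler_pXn2r ?nnegrE ?addr_ge0 ?normc_ge0// ler_normcD.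
by have := sqr_ge0 (normc (g x) - normc (h x)); nra.
Qed.

Lemma inL20 : inL2 m (fun=> 0).
Proof.
apply: (@dominated_inL2 _ 0); first by split; exact: measurable_cst.
by rewrite (normc0 R) expr0n; exact: dominated0.
Qed.

Lemma inL2_sum (n : nat) (c : nat -> R[i]) (F : nat -> Y -> R[i]) :
  (forall i, inL2 m (F i)) -> inL2 m (fun x => \sum_(i < n) c i * F i x).
Proof.
move=> hF; elim: n => [|n IH].
  by under eq_fun do rewrite big_ord0; exact: inL20.
under eq_fun do rewrite big_ord_recr.
by apply: inL2D => //; exact: inL2Z.
Qed.

Lemma inL2_integrable g : inL2 m g ->
  m.-integrable setT (EFin \o (fun x => normc (g x) ^+ 2)).
Proof.
move=> [mg gf]; apply/integrableP; split.
  exact/measurable_EFinP/measurable_sqr_normc.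
apply: le_lt_trans gf; rewrite le_eqVlt; apply/orP; left; apply/eqP.
by apply: eq_integral => x _; rewrite /= ger0_norm// sqr_ge0.
Qed.

Lemma L2sqZ c g : inL2 m g ->
  fine (L2sq m (fun x => c * g x)) = normc c ^+ 2 * fine (L2sq m g).
Proof.
move=> hg; rewrite /L2sq; under eq_integral do rewrite normcM exprMn.
exact: (@RintegralZl _ _ _ _ setT _ _ measurableT (inL2_integrable hg)).
Qed.

Lemma L2sq_quadratic g h : inL2 m g -> inL2 m h ->
  exists b, forall t : R, fine (L2sq m (fun x => g x + t%:C%C * h x)) =
    fine (L2sq m g) + t * b + t ^+ 2 * fine (L2sq m h).
Proof.
move=> hg hh.
(* This is twice the real part of [g] times the conjugate of [h], in a form whose integrability is
   immediate. *)
pose c x := normc (g x + h x) ^+ 2 - normc (g x) ^+ 2 - normc (h x) ^+ 2.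
have ic : m.-integrable setT (EFin \o c).
  have := integrableB measurableT (integrableB measurableT
    (inL2_integrable (inL2D hg hh)) (inL2_integrable hg)) (inL2_integrable hh).
  by apply: eq_integrable.
exists (\int[m]_x c x) => t.
have -> : fine (L2sq m (fun x => g x + t%:C%C * h x)) =
   \int[m]_x (normc (g x) ^+ 2 + t * c x + t ^+ 2 * normc (h x) ^+ 2).
  congr fine; apply: eq_integral => x _; congr EFin.
  rewrite /c !sqr_normc_ReIm !ReD !ImD !ReM !ImM /=; ring.
have itc : m.-integrable setT (EFin \o (fun x => t * c x)).
  exact: (integrableZl measurableT t ic).
have ith : m.-integrable setT (EFin \o (fun x => t ^+ 2 * normc (h x) ^+ 2)).
  exact: (integrableZl measurableT (t ^+ 2) (inL2_integrable hh)).
have igc : m.-integrable setT (EFin \o (fun x => normc (g x) ^+ 2 + t * c x)).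
  exact: (integrableD measurableT (inL2_integrable hg) itc).
rewrite (RintegralD measurableT igc ith).
rewrite (RintegralD measurableT (inL2_integrable hg) itc).
by rewrite !RintegralZl//; exact: inL2_integrable.
Qed.

Section Orbit.
Variables (P : (Y -> R[i]) -> (Y -> R[i])) (hP : L2_contraction m P).
Variables (f : Y -> R[i]) (hf : inL2 m f).

Lemma inL2_iter n : inL2 m (iter n P f).
Proof. by elim: n => //= n IH; case: hP => H _ _ _; exact: H. Qed.

(** A representative of [p(P) f] built from the fixed representatives [iter i P f]: it is linear in
    [p] at every point, and null sets appear only when [P] is applied to it. *)
Definition orbit_eval (p : {poly R[i]}) (x : Y) : R[i] :=
  \sum_(i < size p) p`_i * iter i P f x.

Lemma orbit_eval_widen (p : {poly R[i]}) K x : (size p <= K)%N ->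
  orbit_eval p x = \sum_(i < K) p`_i * iter i P f x.
Proof.
move=> pK; rewrite /orbit_eval.
rewrite -(big_mkord xpredT (fun i => p`_i * iter i P f x)).
rewrite -(big_mkord xpredT (fun i => p`_i * iter i P f x)).
rewrite [RHS](@big_cat_nat _ _ _ (size p))//=.
rewrite [X in _ = _ + X]big_nat [X in _ = _ + X]big1 ?addr0// => i /andP[pi _].
by rewrite nth_default// mul0r.
Qed.

Lemma orbit_evalD p q x : orbit_eval (p + q) x = orbit_eval p x + orbit_eval q x.
Proof.
have K1 : (size p <= maxn (size p) (size q))%N by rewrite leq_maxl.
have K2 : (size q <= maxn (size p) (size q))%N by rewrite leq_maxr.
rewrite (orbit_eval_widen _ (size_polyD p q)) (orbit_eval_widen _ K1).
rewrite (orbit_eval_widen _ K2) -big_split /=.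
by apply: eq_bigr => i _; rewrite coefD mulrDl.
Qed.

Lemma orbit_evalZ c p x : orbit_eval (c *: p) x = c * orbit_eval p x.
Proof.
rewrite (orbit_eval_widen _ (size_scale_leq c p)) mulr_sumr.
by apply: eq_bigr => i _; rewrite coefZ mulrA.
Qed.

Lemma orbit_eval_sum (a : nat -> R[i]) k l x :
  orbit_eval (\sum_(k <= j < l) a j *: 'X^j) x =
  \sum_(k <= j < l) a j * iter j P f x.
Proof.
elim/big_rec2: _ => [|j u v _ <-].
  by rewrite /orbit_eval size_poly0 big_ord0.
rewrite orbit_evalD orbit_evalZ; congr (_ * _ + _).
rewrite /orbit_eval size_polyXn big_ord_recr /= big1 ?add0r => [|i _].
  by rewrite coefXn eqxx mul1r.
by rewrite coefXn ltn_eqF// mul0r.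
Qed.

Lemma inL2_orbit_eval p : inL2 m (orbit_eval p).
Proof. by apply: (@inL2_sum _ (fun i => p`_i)) => i; exact: inL2_iter. Qed.

Lemma contraction_sum (n : nat) (c : nat -> R[i]) :
  {ae m, forall x, P (fun y => \sum_(i < n) c i * iter i P f y) x =
                   \sum_(i < n) c i * iter i.+1 P f x}.
Proof.
have [_ PD PZ _] := hP; elim: n => [|n IH].
  (* The image of the zero function vanishes almost everywhere by homogeneity with scalar 0. *)
  apply: filterS (PZ 0 _ inL20) => x H.
  rewrite [RHS]big_ord0; apply: etrans (mul0r (P (fun=> 0) x)); rewrite -H.
  by congr (P _ x); apply/funext => y; rewrite big_ord0 mul0r.
have H1 := PD _ _ (@inL2_sum n c _ inL2_iter) (inL2Z (c n) (inL2_iter n)).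
have H2 := PZ (c n) _ (inL2_iter n).
apply: filterS3 H1 H2 IH => x H1 H2 IH; rewrite big_ord_recr /= -IH -H2 -H1.
by congr (P _ x); apply/funext => y; rewrite big_ord_recr.
Qed.

Definition orbit_norm_sq (p : {poly R[i]}) : R := fine (L2sq m (orbit_eval p)).

Lemma orbit_norm_hilbert : hilbert_seminorm_sq orbit_norm_sq.
Proof.
split=> [p|c p|p q]; first exact/fine_ge0/L2sq_ge0.
  rewrite /orbit_norm_sq -L2sqZ; last exact: inL2_orbit_eval.
  by congr (fine (L2sq m _)); apply/funext => x; exact: orbit_evalZ.
have [b Hb] := L2sq_quadratic (inL2_orbit_eval p) (inL2_orbit_eval q).
exists b => t; rewrite -Hb; congr (fine (L2sq m _)); apply/funext => x.
by rewrite orbit_evalD orbit_evalZ.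
Qed.

(** Multiplication by ['X] shifts the coefficients, which agrees with applying [P] off a null set,
    and the integral does not see that set. *)
Lemma orbit_norm_mulX p : orbit_norm_sq ('X * p) <= orbit_norm_sq p.
Proof.
have [PL _ _ Pc] := hP.
have -> : orbit_norm_sq ('X * p) = fine (L2sq m (P (orbit_eval p))).
  congr fine; apply: ge0_ae_eq_integral => //.
  - by apply/measurable_EFinP/measurable_sqr_normc; case: (inL2_orbit_eval ('X * p)).
  - by apply/measurable_EFinP/measurable_sqr_normc; case: (PL _ (inL2_orbit_eval p)).
  - by move=> x _; rewrite lee_fin sqr_ge0.
  - by move=> x _; rewrite lee_fin sqr_ge0.
  apply: filterS (contraction_sum (size p) (fun i => p`_i)) => x H _.
  rewrite H; congr (((normc _) ^+ 2)%:E).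
  have sX : (size ('X * p)%R <= (size p).+1)%N.
    by apply: leq_trans (size_polyMleq 'X p) _; rewrite size_polyX.
  rewrite (orbit_eval_widen _ sX) big_ord_recl coefXM mul0r add0r.
  by apply: eq_bigr => i _; rewrite coefXM.
have hp := inL2_orbit_eval p.
by rewrite -lee_fin -!L2sq_fin//; [exact: Pc|exact: PL].
Qed.

Lemma orbit_norm_Xn n : orbit_norm_sq 'X^n = fine (L2sq m (iter n P f)).
Proof.
congr (fine (L2sq m _)); apply/funext => x.
have := orbit_eval_sum (fun=> 1) n n.+1 x.
by rewrite !big_nat1 scale1r mul1r.
Qed.

End Orbit.
End SquareIntegrable.

(** * Maximal functions and almost everywhere convergence *)

Lemma cauchy_cvgC (R : realType) (u : nat -> R[i]) :
  (forall e, 0 < e -> exists p, forall n, (p <= n)%N -> normc (u n - u p) <= e) ->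
  cvgC u.
Proof.
move=> hu.
have cvg_part (pr : R[i] -> R) :
    (forall z w, pr (z - w) = pr z - pr w) -> (forall z, `|pr z| <= normc z) ->
    cvgn (fun n => pr (u n)).
  move=> prB prn; apply: cauchy_cvg; apply: cauchy_exP => e e0.
  have [p Hp] := hu (e / 2) (divr_gt0 e0 (ltr0n _ 2)).
  exists (pr (u p)); exists p => // n /= pn.
  rewrite /ball /= -prB; apply: le_lt_trans (prn _) _; rewrite normcB.
  by apply: le_lt_trans (Hp n pn) _; lra.
have ReB (z w : R[i]) : complex.Re (z - w) = complex.Re z - complex.Re w.
  by case: z w => [x y] [x' y'].
have ImB (z w : R[i]) : complex.Im (z - w) = complex.Im z - complex.Im w.
  by case: z w => [x y] [x' y'].
have /cvg_ex[/= r hr] := cvg_part _ ReB (@normc_ge_absRe R).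
have /cvg_ex[/= s hs] := cvg_part _ ImB (@normc_ge_absIm R).
exists (r +i* s)%C.
have h : (fun n => `|complex.Re (u n) - r| + `|complex.Im (u n) - s|) @ \oo --> (0 : R).
  rewrite -(addr0 0); apply: cvgD.
    by rewrite -(normr0 R^o) -(subrr r); apply: cvg_norm; apply: cvgB => //; exact: cvg_cst.
  by rewrite -(normr0 R^o) -(subrr s); apply: cvg_norm; apply: cvgB => //; exact: cvg_cst.
apply: (squeeze_cvgr _ (@cvg_cst _ _ _ _ _) h).
apply: nearW => n; rewrite normc_ge0 /=.
by apply: le_trans (normc_le_ReIm _) _; rewrite ReB ImB.
Qed.

Section MaximalFunction.
Variables (R : realType) (d : measure_display) (Y : measurableType d)
  (m : {measure set Y -> \bar R}).

(** Monotone convergence for the suprema over [n < K]: the majorant may depend on [K] as long as [c]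
    does not. Terms with [n >= K] are set to 0, which is harmless as [u] is nonnegative. *)
Lemma integral_esups_le (u : nat -> Y -> R) (c : R) :
  (forall n, measurable_fun setT (u n)) -> (forall n x, 0 <= u n x) ->
  (forall K, exists2 G, dominated m G c & forall n x, (n < K)%N -> u n x <= G x) ->
  (\int[m]_x esups (fun n => (u n x)%:E) 0%N <= c%:E)%E.
Proof.
move=> mu u0 hu.
pose v K n x : \bar R := if (n < K)%N then (u n x)%:E else 0%E.
pose h K x := esups (fun n => v K n x) 0%N.
have v0 K n x : (0 <= v K n x)%E by rewrite /v; case: ifP; rewrite // lee_fin.
have vh K n x : (v K n x <= h K x)%E by apply: ereal_sup_ubound; exists n.
have mh K : measurable_fun setT (h K).
  apply: (@measurable_fun_esups _ _ _ setT (v K)) => n; rewrite /v.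
  by case: (n < K)%N => //; exact/measurable_EFinP.
have h0 K x : (0 <= h K x)%E by apply: le_trans (vh K 0%N x).
have hm x : {homo h ^~ x : K L / (K <= L)%N >-> (K <= L)%E}.
  move=> K L KL; apply: ge_ereal_sup => _ [n _ <-].
  apply: le_trans (vh L n x); rewrite /v; case: ifP => // nK.
  - by rewrite (leq_trans nK KL).
  - by case: ifP; rewrite // lee_fin.
have hE x : esups (fun n => (u n x)%:E) 0%N = limn (h ^~ x).
  have /cvg_lim -> // := ereal_nondecreasing_cvgn (hm x).
  apply/eqP; rewrite eq_le; apply/andP; split.
    apply: ge_ereal_sup => _ [n _ <-].
    apply: (@le_trans _ _ (h n.+1 x)).
      by apply: le_trans (vh _ n x); rewrite /v ltnS leqnn.
    by apply: ereal_sup_ubound; exists n.+1.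
  apply: ge_ereal_sup => _ [K _ <-]; apply: ge_ereal_sup => _ [n _ <-].
  have un : ((u n x)%:E <= esups (fun n => (u n x)%:E) 0%N)%E.
    by apply: ereal_sup_ubound; exists n.
  apply: le_trans un; rewrite /v; case: ifP => // _; by rewrite lee_fin.
under eq_integral do rewrite hE.
rewrite monotone_convergence//.
apply: lime_le.
  apply: ereal_nondecreasing_is_cvgn => K L KL.
  by apply: ge0_le_integral => // x _; exact: hm.
apply: nearW => K; have [G [mG G0 Gc] HG] := hu K.
apply: le_trans Gc; apply: ge0_le_integral => //; first exact/measurable_EFinP.
move=> x _; apply: ge_ereal_sup => _ [n _ <-]; rewrite /v.
by case: ifP => nK; rewrite lee_fin//; exact: HG.
Qed.

Variable s : nat -> Y -> R[i].
Hypothesis ms : forall n, Cmeasurable (s n).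

Definition sqr_deviation p n x := normc (s (p + n)%N x - s p x) ^+ 2.

Lemma measurable_sqr_deviation p n : measurable_fun setT (sqr_deviation p n).
Proof.
apply: measurable_sqr_normc.
have := CmeasurableD (ms (p + n)) (CmeasurableZ (-1) (ms p)).
by under eq_fun do rewrite mulN1r.
Qed.

Lemma measurable_esups_deviation p :
  measurable_fun setT (fun x => esups (fun n => (sqr_deviation p n x)%:E) 0%N).
Proof.
apply: (@measurable_fun_esups _ _ _ setT (fun n x => (sqr_deviation p n x)%:E)).
by move=> n; exact/measurable_EFinP/measurable_sqr_deviation.
Qed.

Lemma esups_deviation_ge p n x :
  ((sqr_deviation p n x)%:E <= esups (fun n => (sqr_deviation p n x)%:E) 0%N)%E.
Proof. by apply: ereal_sup_ubound; exists n. Qed.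

Lemma esups_deviation_ge0 p x :
  (0 <= esups (fun n => (sqr_deviation p n x)%:E) 0%N)%E.
Proof.
by apply: le_trans (esups_deviation_ge p 0 x); rewrite lee_fin sqr_ge0.
Qed.

(** The suprema [M i] of squared deviations from time [p i] have integrals at most [1 / (i + 1)], so
    their infimum over i has integral 0 and vanishes almost everywhere. At such a point some [M i]
    lies below [e^2], which is the Cauchy property. *)
Lemma ae_cvgC_of_maximal :
  (forall e, 0 < e -> exists p, forall K, exists2 G, dominated m G e &
     forall n x, (n < K)%N -> sqr_deviation p n x <= G x) ->
  {ae m, forall x, cvgC (s ^~ x)}.
Proof.
move=> hs.
have /choice[p Hp] : forall i : nat, exists p, forall K, exists2 G,
    dominated m G (i.+1%:R^-1) &
    forall n x, (n < K)%N -> sqr_deviation p n x <= G x.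
  by move=> i; apply: hs; rewrite invr_gt0.
pose M i x := esups (fun n => (sqr_deviation (p i) n x)%:E) 0%N.
have mM i : measurable_fun setT (M i) by exact: measurable_esups_deviation.
have M0 i x : (0 <= M i x)%E by exact: esups_deviation_ge0.
have IM i : (\int[m]_x M i x <= (i.+1%:R^-1)%:E)%E.
  apply: integral_esups_le (Hp i) => n; first exact: measurable_sqr_deviation.
  by move=> x; exact: sqr_ge0.
pose I x := einfs (M ^~ x) 0%N.
have mI : measurable_fun setT I by exact: measurable_fun_einfs.
have I0 x : (0 <= I x)%E by apply: le_ereal_inf_tmp => _ [i _ <-].
have II : (\int[m]_x `|I x|)%E = 0%E.
  apply/eqP; rewrite eq_le integral_ge0// andbT.
  apply/lee_addgt0Pr => e e0; rewrite add0e.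
  have [i ie] : exists i : nat, i.+1%:R^-1 < e.
    exists (Num.truncn e^-1); rewrite invf_plt ?posrE//.
    by rewrite truncnS_gt.
  apply: (@le_trans _ _ (\int[m]_x M i x)%E).
    apply: ge0_le_integral => //; first exact: measurableT_comp.
    move=> x _; rewrite gee0_abs//; apply: ereal_inf_lbound; by exists i.
  by apply: le_trans (IM i) _; rewrite lee_fin ltW.
have /(ae_eq_integral_abs _ measurableT mI) := II.
apply: filterS => x /(_ Logic.I) /= Ix0.
apply: cauchy_cvgC => e e0.
have : (I x < (e ^+ 2)%:E)%E by rewrite Ix0 lte_fin exprn_gt0.
move=> /ereal_inf_lt[_ [i _ <-]] Mi; exists (p i) => n pn.
have := esups_deviation_ge (p i) (n - p i) x.
rewrite /sqr_deviation subnKC// => /le_lt_trans/(_ Mi).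
by rewrite lte_fin => /ltW; rewrite ler_pXn2r// nnegrE ?normc_ge0 ?ltW.
Qed.

(** Pointwise, the squared supremum is at most [2 |s p|^2 + 2 M], with [M] the supremum of the
    squared deviations from [s p]; where [M] is infinite this is trivial. *)
Lemma inL2e_sup_of_maximal p c : inL2 m (s p) ->
  (forall K, exists2 G, dominated m G c &
     forall n x, (n < K)%N -> sqr_deviation p n x <= G x) ->
  inL2e m (fun x => ereal_sup [set (normc (s N x))%:E | N in [set N | (p <= N)%N]]).
Proof.
move=> sp hK; pose F x := ereal_sup [set (normc (s N x))%:E | N in [set N | (p <= N)%N]].
pose M x := esups (fun n => (sqr_deviation p n x)%:E) 0%N.
have mM : measurable_fun setT M by exact: measurable_esups_deviation.
have M0 x : (0 <= M x)%E by exact: esups_deviation_ge0.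
have mF : measurable_fun setT F.
  apply: (@measurable_fun_esups _ _ _ setT (fun n x => (normc (s n x))%:E)) => n.
  apply/measurable_EFinP.
  have -> : (fun x => normc (s n x)) = (fun x => (normc (s n x) ^+ 2) `^ 2^-1).
    by apply/funext => x; rewrite powR12_sqrt ?sqr_ge0// sqrtr_sqr ger0_norm ?normc_ge0.
  exact: measurableT_comp (measurable_powR _) (measurable_sqr_normc (ms n)).
have F0 x : (0 <= F x)%E.
  apply: (@le_trans _ _ (normc (s p x))%:E); first by rewrite lee_fin normc_ge0.
  by apply: ereal_sup_ubound; exists p => /=.
have FM x : (F x * F x <= (2 * normc (s p x) ^+ 2)%:E + 2%:E * M x)%E.
  have := M0 x; case ME : (M x) => [mu| |]// mu0; last first.
    by rewrite mulry gtr0_sg// mul1e addey// leey.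
  rewrite lee_fin in mu0.
  set r := Num.sqrt (2 * normc (s p x) ^+ 2 + 2 * mu).
  have r2 : r ^+ 2 = 2 * normc (s p x) ^+ 2 + 2 * mu.
    by rewrite sqr_sqrtr// addr_ge0// mulr_ge0// sqr_ge0.
  have Fr : (F x <= r%:E)%E.
    apply: ge_ereal_sup => _ [N /= pN <-]; rewrite lee_fin.
    rewrite -(ler_pXn2r (n := 2))// ?nnegrE ?normc_ge0 ?sqrtr_ge0// r2.
    have := esups_deviation_ge p (N - p) x; rewrite -/(M x) ME lee_fin.
    rewrite /sqr_deviation subnKC// => Nmu.
    have : normc (s N x) <= normc (s N x - s p x) + normc (s p x).
      by apply: le_trans (ler_normcD _ _); rewrite subrK.
    move: (normc_ge0 (s N x)) (normc_ge0 (s N x - s p x)) (normc_ge0 (s p x)) Nmu.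
    set y := normc (s N x); set v := normc (s N x - s p x); set w := normc (s p x).
    move=> y0 v0 w0 vmu yvw; apply: (@le_trans _ _ ((v + w) ^+ 2)).
      by rewrite ler_pXn2r// nnegrE addr_ge0.
    by have := sqr_ge0 (v - w); nra.
  apply: (@le_trans _ _ (r%:E * r%:E)%E); first exact: lee_pmul.
  by rewrite -!EFinM -EFinD lee_fin -expr2 r2.
have m1 : measurable_fun setT (fun x => (2 * normc (s p x) ^+ 2)%:E).
  apply/measurable_EFinP; apply: measurable_funM => //.
  by apply: measurable_sqr_normc; case: sp.
have m2 : measurable_fun setT (fun x => 2%:E * M x)%E by exact: measurable_funeM.
split => //.
apply: (@le_lt_trans _ _ (\int[m]_x ((2 * normc (s p x) ^+ 2)%:E + 2%:E * M x))%E).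
  apply: ge0_le_integral => //.
  - by move=> x _; exact: (mule_ge0 (F0 x) (F0 x)).
  - exact: (emeasurable_funM mF mF).
  - exact: emeasurable_funD.
  - by move=> x _; exact: FM.
have g1 x : setT x -> (0 <= (2 * normc (s p x) ^+ 2)%:E)%E.
  by move=> _; rewrite lee_fin mulr_ge0// sqr_ge0.
have g2 x : setT x -> (0 <= 2%:E * M x)%E by move=> _; rewrite mule_ge0.
rewrite (ge0_integralD m measurableT g1 m1 g2 m2).
rewrite ge0_integralZl_EFin//.
have [_ _ I1] := dominatedZ (ler0n R 2) (inL2_dominated sp).
have I2 : (\int[m]_x M x <= c%:E)%E.
  apply: integral_esups_le hK => n; first exact: measurable_sqr_deviation.
  by move=> x; exact: sqr_ge0.
apply: lte_add_pinfty; first by apply: le_lt_trans I1 _; rewrite ltry.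
apply: (@le_lt_trans _ _ (2%:E * c%:E)%E); last by rewrite -EFinM ltry.
by rewrite lee_pmul2l.
Qed.

End MaximalFunction.

(** * Weighted sums along an orbit *)

(** Both [k ln 2] and [ln 2] are at most [ln (n + 1)]; adding and squaring gives the constant. This
    turns the Rademacher-Menshov weight into the logarithmic one. *)
Lemma log_weight_ge (R : realType) k n : (2 ^ k <= n)%N ->
  k.+1%:R ^+ 2 <= 4 / ln (2 : R) ^+ 2 * ln (n.+1%:R : R) ^+ 2.
Proof.
move=> kn; have l2 : 0 < ln (2 : R) by rewrite ln_gt0// ltr1n.
have h2 : ln (2 : R) <= ln (n.+1%:R : R).
  rewrite ler_ln ?posrE// ler_nat ltnS; apply: leq_trans kn.
  by rewrite expn_gt0.
have hk : k%:R * ln (2 : R) <= ln (n.+1%:R : R).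
  rewrite mulr_natl -lnXn// -natrX ler_ln ?posrE ?ltr0n ?expn_gt0// ler_nat.
  exact: leqW.
have h : k.+1%:R * ln (2 : R) <= 2 * ln (n.+1%:R : R).
  by rewrite -natr1 mulrDl mul1r; lra.
rewrite mulrAC ler_pdivlMr ?exprn_gt0// -exprMn.
apply: (@le_trans _ _ ((2 * ln (n.+1%:R : R)) ^+ 2)).
  rewrite ler_pXn2r// nnegrE ?mulr_ge0 ?ler0n ?(ltW l2)//.
  by rewrite (le_trans (ltW l2)).
by rewrite exprMn -natrX.
Qed.

Section WeightedOrbit.
Variables (R : realType) (d : measure_display) (Y : measurableType d)
  (m : {measure set Y -> \bar R}).
Variables (a : nat -> R[i]) (P : (Y -> R[i]) -> (Y -> R[i])) (f : Y -> R[i]).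
Hypotheses (ha : norlund_bounded (fun n => (normc (a n))%:C%C))
  (hP : L2_contraction m P) (hf : inL2 m f).

(** The sum stops before [n], so [s (2 ^ q) - s (2 ^ p)] is exactly a dyadic block, and the partial
    sum of the theorem up to [N] is [s N.+1]. *)
Let s n x := \sum_(0 <= j < n) a j * iter j P f x.
Let E n : R := normsum a (2 ^ n.+1) ^+ 2 * fine (L2sq m (iter (2 ^ n) P f)).
Let tau n : R := ln (n.+1%:R : R) ^+ 2 * E n.

Let E_ge0 n : 0 <= E n.
Proof. by rewrite mulr_ge0 ?sqr_ge0//; exact/fine_ge0/L2sq_ge0. Qed.

Lemma orbit_dyadic_increment : exists2 C : R, 0 <= C & forall p q, (p <= q)%N ->
  dominated m (fun x => normc (s (2 ^ q) x - s (2 ^ p) x) ^+ 2)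
    (\sum_(p <= n < q) C * E n).
Proof.
have [C C0 HC] := orbit_dyadic_block_norm (orbit_norm_hilbert hP hf)
  (orbit_norm_mulX hP hf) ha.
exists C => // p q pq.
have -> : (fun x => normc (s (2 ^ q) x - s (2 ^ p) x) ^+ 2) =
    (fun x => normc (orbit_eval P f (\sum_(2 ^ p <= j < 2 ^ q) a j *: 'X^j) x) ^+ 2).
  apply/funext => x; rewrite orbit_eval_sum /s.
  rewrite (@big_cat_nat _ _ _ (2 ^ p) 0 (2 ^ q))//= ?leq_exp2l//.
  by rewrite addrAC subrr add0r.
apply: dominatedW (inL2_dominated (inL2_orbit_eval hP hf _)).
rewrite -mulr_sumr; apply: le_trans (HC p q pq) _.
by under eq_bigr do rewrite orbit_norm_Xn.
Qed.

(** Inside one block, Cauchy-Schwarz with weights [|a_j|] is enough: their total mass is at most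
    [A_(2^(n+1))] and [|P^j f|] does not exceed [|P^(2^n) f|]. The cost is [E n], without
    logarithm. *)
Lemma orbit_block_maximal n : exists2 H : Y -> R, dominated m H (E n) &
  forall N x, (2 ^ n <= N < 2 ^ n.+1)%N -> normc (s N x - s (2 ^ n) x) ^+ 2 <= H x.
Proof.
pose A := \sum_(2 ^ n <= j < 2 ^ n.+1) normc (a j).
have A0 : 0 <= A by apply: sumr_ge0 => j _; exact: normc_ge0.
have AB : A <= normsum a (2 ^ n.+1).
  rewrite /normsum -(big_mkord xpredT (fun k => normc (a k))) /=.
  rewrite (@big_cat_nat _ _ _ (2 ^ n) 0 (2 ^ n.+1).+1)//=; last first.
    by rewrite ltnW// ltnS leq_exp2l.
  apply: ler_wpDl; first by apply: sumr_ge0 => j _; exact: normc_ge0.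
  apply: sum_nat_mono => //; last by rewrite leq_exp2l.
  by move=> j; exact: normc_ge0.
exists (fun x => A * \sum_(2 ^ n <= j < 2 ^ n.+1)
                       normc (a j) * normc (iter j P f x) ^+ 2).
  apply: dominatedW; last first.
    apply: dominatedZ => //; apply: dominated_sum => j _.
    by apply: dominatedZ (normc_ge0 _) (inL2_dominated (inL2_iter hP hf j)).
  apply: (@le_trans _ _ (A * \sum_(2 ^ n <= j < 2 ^ n.+1)
      normc (a j) * fine (L2sq m (iter (2 ^ n) P f)))).
    rewrite ler_wpM2l// big_nat [leRHS]big_nat; apply: ler_sum => j /andP[nj _].
    rewrite ler_wpM2l ?normc_ge0// -!orbit_norm_Xn.
    exact: (orbit_norm_nonincr (orbit_norm_mulX hP hf)).
  rewrite -mulr_suml mulrA -expr2 ler_wpM2r//; first exact/fine_ge0/L2sq_ge0.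
  by rewrite ler_pXn2r ?nnegrE ?normsum_ge0.
move=> N x /andP[nN Nn].
apply: le_trans (weighted_Cauchy_Schwarz _ _ (fun j => normc_ge0 (a j))).
have sum0 k l : 0 <= \sum_(k <= j < l) normc (a j) * normc (iter j P f x).
  by apply: sumr_ge0 => j _; rewrite mulr_ge0 ?normc_ge0.
rewrite ler_pXn2r ?nnegrE ?normc_ge0//.
rewrite /s (@big_cat_nat _ _ _ (2 ^ n) 0 N)//= addrAC subrr add0r.
apply: le_trans (ler_normc_sum _ _) _.
rewrite (eq_bigr (fun j => normc (a j) * normc (iter j P f x))) => [|j _]; last first.
  exact: normcM.
apply: sum_nat_mono => //; last exact: ltnW.
by move=> j; rewrite mulr_ge0 ?normc_ge0.
Qed.

(* [2 ^ (2 ^ b)] occurs because the times are split dyadically, and the indices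
   of these blocks once more. *)
Lemma orbit_maximal : exists2 C : R, 0 < C & forall b K, (b <= K)%N ->
  exists2 G : Y -> R, dominated m G (C * \sum_(2 ^ b <= n < 2 ^ K) tau n) &
    forall N x, (2 ^ (2 ^ b) <= N < 2 ^ (2 ^ K))%N ->
      normc (s N x - s (2 ^ (2 ^ b)) x) ^+ 2 <= G x.
Proof.
have [C C0 HC] := orbit_dyadic_increment.
have /choice[H HH] : forall n, exists H : Y -> R, dominated m H (E n) /\
    forall N x, (2 ^ n <= N < 2 ^ n.+1)%N ->
      normc (s N x - s (2 ^ n) x) ^+ 2 <= H x.
  by move=> n; have [H h1 h2] := orbit_block_maximal n; exists H.
have H0 n x : 0 <= H n x by case: (HH n) => -[].
set L : R := 4 / ln 2 ^+ 2.
have L0 : 0 <= L by rewrite divr_ge0// sqr_ge0.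
have LE k n : (2 ^ k <= n)%N -> k.+1%:R ^+ 2 * E n <= L * tau n.
  by move=> kn; rewrite /tau mulrA ler_wpM2r//; exact: log_weight_ge.
have tau0 n : 0 <= tau n by rewrite mulr_ge0// sqr_ge0.
(* Twice the 12 of Rademacher-Menshov for the dyadic times, [2 L] for the blocks, and 1 to make the
   constant positive, since it is divided by later. *)
exists (24 * C * L + 2 * L + 1) => [|b K bK].
  have := mulr_ge0 C0 L0; move: L0; clearbody L; lra.
have [|G hG HG] := @Rademacher_Menshov _ _ _ m (fun k => s (2 ^ k))
    (fun n => C * E n) (fun n => mulr_ge0 C0 (E_ge0 n)) HC
    (fun n => C * (L * tau n)) b K bK.
  move=> k n /andP[kn _]; rewrite mulrCA ler_wpM2l//; exact: LE.
exists (fun x => 2 * G x + 2 * \sum_(2 ^ b <= n < 2 ^ K) H n x).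
  apply: dominatedW (dominatedD (dominatedZ (ler0n R 2) hG)
    (dominatedZ (ler0n R 2) (dominated_sum (fun n _ => (HH n).1)))).
  rewrite -!mulr_sumr; set t := \sum_(_ <= _ < _) tau _.
  have t0 : 0 <= t by exact: sumr_ge0.
  have : \sum_(2 ^ b <= n < 2 ^ K) E n <= L * t.
    rewrite mulr_sumr big_nat [leRHS]big_nat; apply: ler_sum => n /andP[bn _].
    (* The comparison of [E n] with [tau n] needs [n >= 1], as [tau 0] is 0. *)
    have n0 : (2 ^ 0 <= n)%N by apply: leq_trans bn; rewrite leq_exp2l.
    by have := LE _ _ n0; rewrite expr1n mul1r.
  lra.
move=> N x /andP[bN NK].
have N0 : (0 < N)%N by apply: leq_trans bN; rewrite expn_gt0.
pose n := trunc_log 2 N.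
have /andP[nN Nn] := @trunc_log_bounds 2 N isT N0; rewrite -/n in nN Nn.
have bn : (2 ^ b <= n)%N.
  by rewrite -ltnS -(@ltn_exp2l 2)//; exact: leq_ltn_trans Nn.
have nK : (n < 2 ^ K)%N.
  by rewrite -(@ltn_exp2l 2)//; exact: leq_ltn_trans NK.
have h1 : normc (s N x - s (2 ^ n) x) ^+ 2 <= \sum_(2 ^ b <= n < 2 ^ K) H n x.
  apply: le_trans (@nat_sum_ge_term _ _ _ n _ (fun n => H0 n x) _).
    by case: (HH n) => _; apply; rewrite nN.
  by rewrite bn.
have h2 : normc (s (2 ^ n) x - s (2 ^ (2 ^ b)) x) ^+ 2 <= G x.
  by apply: HG; rewrite bn ltnW.
have : normc (s N x - s (2 ^ (2 ^ b)) x) <=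
    normc (s N x - s (2 ^ n) x) + normc (s (2 ^ n) x - s (2 ^ (2 ^ b)) x).
  by apply: le_trans (ler_normcD _ _); rewrite addrA subrK.
move: h1 h2 (normc_ge0 (s N x - s (2 ^ n) x))
  (normc_ge0 (s (2 ^ n) x - s (2 ^ (2 ^ b)) x))
  (normc_ge0 (s N x - s (2 ^ (2 ^ b)) x)).
set u := normc (s N x - s (2 ^ n) x).
set v := normc (s (2 ^ n) x - s (2 ^ (2 ^ b)) x).
set w := normc (s N x - s (2 ^ (2 ^ b)) x) => h1 h2 u0 v0 w0 wuv.
apply: (@le_trans _ _ ((u + v) ^+ 2)).
  by rewrite ler_pXn2r// nnegrE addr_ge0.
by have := sqr_ge0 (u - v); nra.
Qed.

End WeightedOrbit.

(** * Tails of the hypothesis and conclusion *)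

Lemma bounded_tail_sum (R : realType) (t : nat -> R) (B : R) (k0 : nat) :
  (forall n, 0 <= t n) -> (forall K, \sum_(k0 <= n < K) t n <= B) ->
  forall e, 0 < e -> exists2 N, (k0 <= N)%N & forall N' K, (N <= N')%N ->
    \sum_(N' <= n < K) t n <= e.
Proof.
move=> t0 tB e e0; pose S := range (fun K => \sum_(k0 <= n < K) t n).
have hS : has_sup S.
  by split; [exists (\sum_(k0 <= n < 0) t n), 0%N|exists B => _ [K _ <-]].
have [_ [N _ <-] HN] := sup_adherent e0 hS.
exists (maxn k0 N) => [|N' K]; first by rewrite leq_maxl.
rewrite geq_max => /andP[kN' NN'].
have [KN|NK] := leqP K N'; first by rewrite big_geq// ltW.
have h1 : \sum_(k0 <= n < K) t n <= sup S by apply: ub_le_sup; [case: hS|exists K].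
have h2 : \sum_(k0 <= n < N) t n <= \sum_(k0 <= n < N') t n.
  have [k0N|Nk0] := leqP k0 N; first exact: sum_nat_mono.
  by rewrite big_geq ?(ltnW Nk0)// sumr_ge0.
rewrite (@big_cat_nat _ _ _ N' k0 K)//= in h1; last exact: ltnW.
lra.
Qed.

Theorem mainTheorem9 (R : realType) (d : measure_display) (Y : measurableType d)
  (m : {measure set Y -> \bar R}) (hm : sigma_finite setT m)
  (a : nat -> R[i])
  (ha : norlund_bounded (fun n => (normc (a n))%:C%C))
  (P : (Y -> R[i]) -> (Y -> R[i])) (hP : L2_contraction m P)
  (f : Y -> R[i]) (hf : inL2 m f)
  (hsum : (\sum_(1 <= n <oo)
             ((ln (n.+1%:R : R)) ^+ 2 * (normsum a (2 ^ n.+1)%N) ^+ 2)%:E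
               * L2sq m (iter (2 ^ n)%N P f) < +oo)%E) :
  {ae m, forall x, cvgC (fun N => \sum_(n < N.+1) a n * iter n P f x)} /\
  inL2e m (fun x => ereal_sup [set (normc (\sum_(n < N.+1) a n * iter n P f x))%:E
                              | N in [set N : nat | (1 <= N)%N]]).
Proof.
pose s n x := \sum_(0 <= j < n) a j * iter j P f x.
pose tau n : R := ln (n.+1%:R : R) ^+ 2 *
  (normsum a (2 ^ n.+1) ^+ 2 * fine (L2sq m (iter (2 ^ n) P f))).
have tau0 n : 0 <= tau n.
  apply: mulr_ge0; first exact: sqr_ge0.
  by apply: mulr_ge0; [exact: sqr_ge0|exact/fine_ge0/L2sq_ge0].
have tauE n : (((ln (n.+1%:R : R)) ^+ 2 * (normsum a (2 ^ n.+1)%N) ^+ 2)%:E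
               * L2sq m (iter (2 ^ n)%N P f))%E = (tau n)%:E.
  by rewrite (L2sq_fin (inL2_iter hP hf _)) -EFinM /tau mulrA.
have [B tauB] : exists B, forall K, \sum_(1 <= n < K) tau n <= B.
  have {}hsum : (\sum_(1 <= n <oo) (tau n)%:E < +oo)%E.
    apply: le_lt_trans hsum; rewrite le_eqVlt; apply/orP; left; apply/eqP.
    by congr (limn _); apply/funext => n; apply: eq_bigr => i _; rewrite tauE.
  exists (fine (\sum_(1 <= n <oo) (tau n)%:E)) => K.
  rewrite -lee_fin fineK; last first.
    rewrite ge0_fin_numE//; apply: nneseries_ge0 => n _ _.
    by rewrite lee_fin.
  rewrite -sumEFin; apply: nneseries_lim_ge => n _ _; by rewrite lee_fin.
have [C C0 HC] := orbit_maximal ha hP hf.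
have maximal b e K : (forall L, \sum_(2 ^ b <= n < 2 ^ L) tau n <= e) ->
    exists2 G, dominated m G (C * e) & forall n x, (n < K)%N ->
      sqr_deviation s (2 ^ (2 ^ b)) n x <= G x.
  (* This [L] is large enough for [2 ^ (2 ^ L)] to exceed every time [2 ^ (2 ^ b) + n] with
     [n < K]. *)
  move=> tl; pose L := (b + K)%N; have [G hG HG] := HC b L (leq_addr K b).
  exists G => [|n x nK]; first by apply: dominatedW hG; rewrite ler_pM2l.
  apply: HG; rewrite leq_addr /=.
  have h1 k : (k < 2 ^ k)%N by exact: ltn_expl.
  have h2 : (2 ^ b + K <= 2 ^ L)%N.
    rewrite expnD; have := h1 K; have : (0 < 2 ^ b)%N by rewrite expn_gt0.
    nia.
  apply: (@leq_trans (2 ^ (2 ^ b) + K)); first by rewrite ltn_add2l.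
  apply: (@leq_trans (2 ^ (2 ^ b + K))); last by rewrite leq_exp2l.
  rewrite expnD; have := h1 K; have : (0 < 2 ^ (2 ^ b))%N by rewrite expn_gt0.
  nia.
have hF n := inL2_iter hP hf n.
have sL n : inL2 m (s n).
  rewrite /s; under eq_fun do rewrite big_mkord; exact: inL2_sum.
have ms n : Cmeasurable (s n) by case: (sL n).
split.
  have H : {ae m, forall x, cvgC (s ^~ x)}.
    apply: ae_cvgC_of_maximal => // e e0.
    have [N _ HN] := bounded_tail_sum tau0 tauB (divr_gt0 e0 C0).
    exists (2 ^ (2 ^ N))%N => K; rewrite -[e](divfK (lt0r_neq0 C0)) mulrC.
    by apply: maximal => L; apply: HN; rewrite ltnW// ltn_expl.
  apply: filterS H => x [l hl]; exists l.
  have := cvg_comp _ _ (@cvg_addnr 1) hl.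
  apply: cvg_trans; apply: near_eq_cvg; apply: nearW => N /=.
  by rewrite /s addn1 big_mkord.
(* With [b = 0] the starting time is [2 ^ (2 ^ 0) = 2], and [s 2] is the partial sum for [N = 1];
   the sum of [tau] starts at [2 ^ 0 = 1], as in the hypothesis. *)
have max2 K : exists2 G, dominated m G (C * B) & forall n x, (n < K)%N ->
    sqr_deviation s 2 n x <= G x.
  by apply: (maximal 0%N B K) => L; exact: tauB.
have := inL2e_sup_of_maximal ms (sL 2%N) max2.
congr (inL2e m _); apply/funext => x; congr ereal_sup; apply/seteqP; split.
  move=> _ [[|N] //= N2 <-]; exists N => //.
  by rewrite /s big_mkord.
by move=> _ [N /= N1 <-]; exists N.+1 => //=; rewrite /s big_mkord.
Qed.
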